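(* (In $ZFC$.) Let $0<d\le 2$ be a real number. Then there exists no set $S\subset\mathbb{R}^2$ that is both $\mathcal{H}^d$-measurable and a Sierpiński set in the sense of cardinality.
   Context: $\mathcal{H}^d$ denotes the $d$-dimensional Hausdorff (outer) measure on $\mathbb{R}^2$, and $\mathcal{H}^d$-measurable means measurable in the sense of Carathéodory. A set $S\subset\mathbb{R}^2$ is a Sierpiński set in the sense of cardinality if $S\cap(\{x\}\times\mathbb{R})$ is countable for every $x\in\mathbb{R}$ (each vertical line) and $(\mathbb{R}\times\{y\})\setminus S$ is countable for every $y\in\mathbb{R}$ ($S$ is co-countable on each horizontal line). *)

(* Defs.v *)
From mathcomp Require Import all_boot all_order all_algebra.
From mathcomp Require Import all_classical all_reals all_analysis.

Set Implicit Arguments.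
Unset Strict Implicit.
Unset Printing Implicit Defensive.

Import Order.TTheory GRing.Theory Num.Theory.

Local Open Scope classical_set_scope.
Local Open Scope ring_scope.

(* The plane is [R * R], whose library norm is the sup norm, hence the
   explicit Euclidean distance. *)
Definition euclid_dist (R : realType) (p q : R * R) : R :=
  Num.sqrt ((p.1 - q.1) ^+ 2 + (p.2 - q.2) ^+ 2).

(* The point 0 only matters for the empty set: [ereal_sup set0] is [-oo]. *)
Definition diam (R : realType) (A : set (R * R)) : \bar R :=
  ereal_sup (0%E |` [set (euclid_dist p q)%:E | p in A & q in A]).

Definition hausdorff_delta (R : realType) (d delta : R) (A : set (R * R)) :
    \bar R :=
  ereal_inf [set (\sum_(n <oo) (diam (U n) `^ d))%E |
    U in [set U : (set (R * R))^nat |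
            A `<=` \bigcup_n U n /\ forall n, (diam (U n) <= delta%:E)%E]].

(* No normalising constant: multiplying by a positive real does not change the
   Caratheodory measurable sets. *)
Definition hausdorff_measure (R : realType) (d : R) (A : set (R * R)) :
    \bar R :=
  ereal_sup [set hausdorff_delta d delta A | delta in [set e : R | 0 < e]].

Definition sierpinski_cardinality (R : realType) (S : set (R * R)) : Prop :=
  (forall x : R, countable (S `&` ([set x] `*` [set: R]))) /\
  (forall y : R, countable (([set: R] `*` [set y]) `\` S)).

(* Main.v *)
(** Put [q = d / 2]. There is a map [f] from [[0, 1[] into the reals sending
    dyadic intervals of length [2^-n] to sets of diameter comparable to [r^n],
    where [r^q = 1/2]: the identity for [q = 1], the inverse of a Cantor function
    otherwise. Hence [F = f x f] maps the unit square [Q] onto a set of finite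
    [H^d]-measure, and a set is Lebesgue-null in [Q] whenever its image is
    [H^d]-null. Let [A] be the set of points of [Q] mapped into the Sierpinski
    set [S]. There is a Borel set [G] between [A] and [Q] with
    [H^d (F G) = H^d (F A)], so, [S] being Caratheodory measurable,
    [F (G \ A)] is [H^d]-null and [G \ A] is Lebesgue-null. By Fubini along
    horizontal lines [G] has measure 1, whereas along vertical lines [A], hence
    also [G], has measure 0. *)
Require Import Defs.
From mathcomp Require Import all_boot all_order all_algebra.
From mathcomp Require Import all_classical all_reals all_analysis.
From mathcomp Require Import ring lra.

Import Order.TTheory GRing.Theory Num.Theory.
Import numFieldNormedType.Exports.

Local Open Scope classical_set_scope.
Local Open Scope ring_scope.

(** * Dyadic intervals and geometric sums *)

Lemma exists_scaled_expr_le {R : realType} (K r e : R) :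
  0 <= K -> 0 <= r < 1 -> 0 < e -> exists n, K * r ^+ n <= e.
Proof.
(* Dividing by [K + 1] rather than [K] covers the case [K = 0]. *)
move=> K0 /andP[r0 r1] e0; have K1 : 0 < K + 1 by rewrite ltr_wpDl.
have : (r ^+ n : R) @[n --> \oo] --> 0.
  by apply: cvg_expr; rewrite ger0_norm.
move=> /cvgr0_norm_le /(_ (e / (K + 1)) (divr_gt0 e0 K1)).
move=> [n _ /(_ n (leqnn _))] /=; rewrite ger0_norm ?exprn_ge0// => h.
exists n; rewrite ler_pdivlMr// mulrC in h.
by apply: le_trans h; rewrite ler_wpM2r ?exprn_ge0// lerDl.
Qed.

Definition dyadic_cell {R : realType} (n : nat) (t : R) : nat :=
  Num.truncn (2 ^+ n * t).

Lemma dyadic_cellP {R : realType} (n k : nat) (t : R) : 0 <= t ->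
  dyadic_cell n t = k <-> k%:R <= 2 ^+ n * t < k.+1%:R.
Proof.
move=> t0; have nt0 : 0 <= 2 ^+ n * t by rewrite mulr_ge0// exprn_ge0.
split=> [<-|]; first exact: truncn_itv.
exact: truncn_def.
Qed.

Lemma dyadic_cell_eq_dist {R : realType} (n : nat) (s t : R) :
  0 <= s -> 0 <= t -> dyadic_cell n s = dyadic_cell n t ->
  `|s - t| <= 2^-1 ^+ n.
Proof.
move=> s0 t0 /esym/(dyadic_cellP _ _ _ t0) => /andP[kt tk].
have /andP[ks sk] := (dyadic_cellP n _ _ s0).1 erefl.
have n0 : 0 < 2 ^+ n :> R by rewrite exprn_gt0.
rewrite -(ler_pM2l n0) -{1}(gtr0_norm n0) -normrM exprVn divff ?gt_eqF//.
rewrite mulrBr ler_norml -natr1 in sk tk *.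
by apply/andP; split; lra.
Qed.

Lemma dyadic_cell_le {R : realType} (n : nat) (s t : R) :
  s <= t -> (dyadic_cell n s <= dyadic_cell n t)%N.
Proof. by move=> st; apply: le_truncn; rewrite ler_pM2l// exprn_gt0. Qed.

(** Dyadic intervals are nested: if the cells of level [i] differ, the left endpoint of the later
    one separates [s] from [t]. Its index at level [n] is [dyadic_cell i t * 2 ^ (n - i)]. *)
Lemma dyadic_cell_mono {R : realType} (i n : nat) (s t : R) : (i <= n)%N ->
  0 <= s -> 0 <= t ->
  dyadic_cell n s = dyadic_cell n t -> dyadic_cell i s = dyadic_cell i t.
Proof.
wlog st : s t / s <= t.
  move=> H ni s0 t0 e; case: (leP s t) => [/H|/ltW /H]; first exact.
  by move=> /(_ ni t0 s0 (esym e))/esym.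
move=> ni s0 t0 e; apply/eqP; rewrite eqn_leq dyadic_cell_le//=.
have n0 : 0 < 2 ^+ (n - i) :> R by rewrite exprn_gt0.
have /andP[ks sk] := (dyadic_cellP i _ _ s0).1 erefl.
have /andP[kt tk] := (dyadic_cellP i _ _ t0).1 erefl.
rewrite leqNgt; apply/negP => lt.
have : (dyadic_cell n s < dyadic_cell n t)%N.
  have E : forall x : R, 2 ^+ n * x = 2 ^+ (n - i) * (2 ^+ i * x).
    by move=> x; rewrite mulrA -exprD subnK.
  have [i0 i1] : (dyadic_cell i t * 2 ^ (n - i) <= dyadic_cell n t)%N /\
    (dyadic_cell n s < dyadic_cell i t * 2 ^ (n - i))%N.
    split.
      rewrite /dyadic_cell truncn_ge_nat; last by rewrite mulr_ge0// exprn_ge0.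
      by rewrite E natrM natrX mulrC ler_pM2l.
    rewrite [X in (X < _)%N]/dyadic_cell truncn_lt_nat.
      rewrite E natrM natrX mulrC ltr_pM2r//.
      by rewrite (lt_le_trans sk)// ler_nat.
    by rewrite mulr_ge0// exprn_ge0.
  exact: leq_trans i1 i0.
by rewrite e ltnn.
Qed.

(** Take the least [n] with [2^-n <= t - s]. Minimality gives the upper bound, and points at least
    one cell length apart lie in different cells. *)
Lemma dyadic_separation {R : realType} (s t : R) :
  0 <= s -> s < t -> t < 1 ->
  exists n, t - s <= 2 * 2^-1 ^+ n /\
    (dyadic_cell n s < dyadic_cell n t)%N.
Proof.
move=> s0 st t1.
have h0 : 0 < t - s by rewrite subr_gt0.
have exn : exists n, 2^-1 ^+ n <= t - s.
  have half : 0 <= (2^-1 : R) < 1 by lra.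
  have [n] := exists_scaled_expr_le 1 2^-1 (t - s) ler01 half h0.
  by rewrite mul1r; exists n.
case: (ex_minnP exn) => n hn nmin; exists n; split.
  case: n hn nmin => [|n] hn nmin; first by rewrite expr0; lra.
  rewrite exprS mulrA mulfV ?mul1r//.
  by case: (leP (t - s) (2^-1 ^+ n)) => // /ltW /nmin; rewrite ltnn.
have /andP[ks sk] := (dyadic_cellP n _ _ s0).1 erefl.
rewrite {2}/dyadic_cell truncn_gt_nat.
have n0 : 0 < 2 ^+ n :> R by rewrite exprn_gt0.
move: hn; rewrite -(ler_pM2l n0) exprVn mulfV ?gt_eqF// mulrBr => hn.
by rewrite -natr1; lra.
Qed.

(** The left side telescopes to [x^m - x^n] when [m <= n]. *)
Lemma geometric_tail_le {R : realType} (x : R) (m n : nat) : 0 <= x ->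
  (1 - x) * \sum_(m <= i < n) x ^+ i <= x ^+ m.
Proof.
move=> x0; have [nm|/ltnW mn] := leqP n m.
  by rewrite big_geq// mulr0 exprn_ge0.
rewrite mulr_sumr (eq_bigr (fun i => - (x ^+ i.+1 - x ^+ i))); last first.
  by move=> i _; rewrite exprS; ring.
by rewrite sumrN telescope_sumr// opprB gerBl exprn_ge0.
Qed.

(** * The map [f] *)

(** The root is [2^(-1/q)]. Since [r = r^q * r^(1 - q)] equals [r^(1 - q) / 2], having [q < 1]
    forces [2 * r < 1], the ratio of the series that defines [f]. *)
Lemma powR_half_root {R : realType} (q : R) : 0 < q -> q < 1 ->
  exists r : R, [/\ 0 < r, 2 * r < 1 & r `^ q = 2^-1].
Proof.
move=> q0 q1; pose r : R := 2^-1 `^ q^-1.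
have r0 : 0 < r by rewrite powR_gt0// invr_gt0.
have rq : r `^ q = 2^-1.
  by rewrite /r -powRrM mulVf ?gt_eqF// powRr1// invr_ge0.
have r1 : r < 1.
  rewrite ltNge; apply/negP => r1.
  have := @ge0_ler_powR R q (ltW q0) 1 r.
  rewrite !nnegrE ler01 (ltW r0) powR1 rq => /(_ isT isT r1); lra.
exists r; split=> //; rewrite -ltr_pdivlMl// mulr1.
have -> : r = 2^-1 * r `^ (1 - q).
  by rewrite -rq -powRD ?subrKC ?powRr1 ?(ltW r0)// oner_eq0.
rewrite gtr_pMr ?invr_gt0//.
have := @gt0_ltr_powR R (1 - q) _ r 1; rewrite !nnegrE powR1; apply => //.
- by rewrite subr_gt0.
- exact: ltW.
Qed.

(** As [r^q = 1/2], the length [2^-n] of a cell is [(r^n)^q]. The fourth clause, a Hoelder condition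
    of exponent [q] on the inverse of [f], will bound Lebesgue measure by Hausdorff measure; the
    fifth bounds Hausdorff measure from above. *)
Definition cantor_embedding {R : realType} (q r C : R) (f : R -> R) : Prop :=
  [/\ 0 < r < 1, 0 <= C, r `^ q = 2^-1,
    (forall s t, 0 <= s < 1 -> 0 <= t < 1 ->
       `|s - t| <= 2 * `|f s - f t| `^ q) &
    (forall n s t, 0 <= s < 1 -> 0 <= t < 1 ->
       dyadic_cell n s = dyadic_cell n t -> `|f s - f t| <= C * r ^+ n)].

(* For [q < 1] the map [f] is the inverse of a Cantor function: the image of [0, 1[
   is a self-similar set of dimension [q]. *)
Lemma exists_cantor_embedding {R : realType} (q : R) : 0 < q -> q <= 1 ->
  exists (f : R -> R) (r C : R), cantor_embedding q r C f.
Proof.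
move=> q0; rewrite le_eqVlt => /predU1P[->|q1].
  exists id, 2^-1, 1; split; rewrite ?powRr1//; first by lra.
  - by move=> s t _ _; rewrite powRr1// ler_peMl// ler1n.
  - by move=> n s t /andP[s0 _] /andP[t0 _] /dyadic_cell_eq_dist; rewrite mul1r; exact.
have [r [r0 r21 rq]] := powR_half_root q q0 q1.
(* Summing over [i] gives the Cantor series of the binary digits [b_j] of [t], the sum of the
   [b_j * r^j], up to the factor [1 / (1 - 2 * r)]. With integer parts in place of digits every term
   is nondecreasing in [t]. *)
pose u (t : R) i := r ^+ i * (dyadic_cell i t)%:R.
have u0 t i : 0 <= u t i by rewrite mulr_ge0// exprn_ge0// ltW.
have c0 : 0 < 1 - 2 * r by lra.
have cvgu t : 0 <= t < 1 -> cvgn (series (u t)).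
  move=> /andP[t0 t1]; apply: nondecreasing_is_cvgn.
    apply/nondecreasing_seqP => n.
    by rewrite !seriesEnat/= big_nat_recr//= lerDl.
  exists (1 - 2 * r)^-1 => _ [n _ <-]; rewrite seriesEnat/=.
  (* The terms are dominated by [(2 * r)^i]. *)
  rewrite -[X in _ <= X]mul1r ler_pdivlMr// mulrC.
  apply: le_trans (geometric_tail_le (2 * r) 0 n _); last by lra.
  rewrite ler_pM2l// ler_sum// => i _; rewrite /u mulrC exprMn.
  rewrite ler_pM2r ?exprn_gt0//.
  have /andP[+ _] := (dyadic_cellP i _ _ t0).1 erefl.
  by move=> /le_trans; apply; rewrite ger_pMr ?exprn_gt0// ltW.
pose f (t : R) : R := limn (series (u t)).
have cvgf s t : 0 <= s < 1 -> 0 <= t < 1 ->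
    (series (u s) N - series (u t) N) @[N --> \oo] --> f s - f t.
  by move=> hs ht; apply: cvgB; exact: cvgu.
exists f, r, (2 / (1 - 2 * r)); split=> //.
- by rewrite r0; lra.
- by rewrite divr_ge0// ltW.
- move=> s t; wlog st : s t / s < t.
    move=> H hs ht; have [st|st|->] := ltgtP s t; first exact: H.
      by rewrite distrC (distrC (f s)); exact: H.
    by rewrite subrr normr0 mulr_ge0// powR_ge0.
  move=> /[dup] hs /andP[s0 s1] /[dup] ht /andP[t0 t1].
  have [n [nts lt]] := dyadic_separation s t s0 st t1.
  (* At level [n] the cells differ, so that term alone contributes at least [r^n]; the other
     differences are nonnegative. *)
  have rn : r ^+ n <= f t - f s.
    apply: (cvgr_to_ge (cvgf _ _ ht hs)); exists n.+1 => // N /= nN.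
    rewrite !seriesEnat/= -sumrB (big_nat_widenl _ 0)//.
    rewrite (bigD1_seq n) ?mem_index_iota ?iota_uniq//=.
    rewrite -[leLHS]addr0 lerD//.
      by rewrite /u -mulrBr ler_pMr ?exprn_gt0// lerBrDr -(natrD _ 1) ler_nat.
    apply: sumr_ge0 => i _; rewrite subr_ge0 ler_pM2l ?exprn_gt0// ler_nat.
    exact/dyadic_cell_le/ltW.
  rewrite distrC gtr0_norm ?subr_gt0// distrC ger0_norm; last first.
    by rewrite (le_trans _ rn)// exprn_ge0// ltW.
  (* Here [2^-n] is rewritten as [(r^n)^q], and [x^q] is monotone. *)
  apply: (le_trans nts); rewrite ler_pM2l// -rq.
  rewrite -powR_mulrn ?powR_ge0// powRAC powR_mulrn ?(ltW r0)//.
  apply: ge0_ler_powR; rewrite ?(ltW q0)// nnegrE ?exprn_ge0 ?(ltW r0)//.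
  by rewrite (le_trans _ rn)// exprn_ge0// ltW.
- move=> n s t hs ht e; have [[s0 _] [t0 _]] := (andP hs, andP ht).
  have cvgn' : `|series (u s) N - series (u t) N| @[N --> \oo] --> `|f s - f t|.
    exact: cvg_norm (cvgf _ _ hs ht).
  apply: (cvgr_to_le cvgn'); exists n => // N /= nN.
  (* Terms below [n] cancel by nesting. For [i >= n] the integer parts differ by at most
     [2^i * |s - t| + 1 <= 2 * 2^(i - n)], which leaves [2 * 2^-n] times a geometric tail of ratio
     [2 * r]. *)
  rewrite !seriesEnat/= -sumrB (big_cat_nat (n := n))//= big1_seq ?add0r; last first.
    move=> i /andP[_]; rewrite mem_index_iota => /andP[_ /ltnW ni].
    by rewrite /u (dyadic_cell_mono i n s t ni s0 t0 e) subrr.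
  rewrite mulrAC ler_pdivlMr// mulrC.
  have -> : 2 * r ^+ n = 2 * 2^-1 ^+ n * (2 * r) ^+ n.
    by rewrite exprMn exprVn -mulrA mulKf// expf_neq0.
  rewrite -[leRHS]mulrC.
  have r20 : 0 <= 2 * r by lra.
  have g := geometric_tail_le (2 * r) n N r20.
  have k0 : 0 < 2 * 2^-1 ^+ n :> R by rewrite mulr_gt0// exprn_gt0.
  rewrite -(ler_pM2r k0) in g; apply: le_trans g.
  rewrite -mulrA ler_pM2l// mulr_suml.
  apply: (le_trans (ler_norm_sum _ _ _)); apply: ler_sum_nat => i /andP[ni _].
  rewrite /u -mulrBr normrM ger0_norm ?exprn_ge0 ?(ltW r0)//.
  rewrite exprMn [2 ^+ i * _]mulrC -mulrA ler_pM2l ?exprn_gt0//.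
  have dst := dyadic_cell_eq_dist n s t s0 t0 e.
  have /andP[csi] := (dyadic_cellP i _ _ s0).1 erefl.
  have /andP[cti] := (dyadic_cellP i _ _ t0).1 erefl.
  rewrite -[X in _ < X -> _]natr1 => tci.
  rewrite -[X in _ < X -> _]natr1 => sci.
  have i0 : 0 < 2 ^+ i :> R by rewrite exprn_gt0.
  have ni1 : 1 <= 2 ^+ i * 2^-1 ^+ n :> R.
    by rewrite exprVn -exprB// ?unitfE// exprn_ege1// ler1n.
  rewrite -(ler_pM2l i0) -{1}(gtr0_norm i0) -normrM mulrBr ler_norml in dst.
  case/andP: dst => d1 d2; rewrite ler_norml.
  by apply/andP; split; lra.
Qed.

(** * Fubini for sets sandwiched between measurable ones *)

(** The product measure [\x] integrates the measures of vertical sections; by uniqueness it is also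
    the iterated integral [\x^] over horizontal ones, which is bounded below on [F]. *)
Lemma product_measure_ge_ysection d1 d2 (T1 : measurableType d1)
    (T2 : measurableType d2) (R : realType)
    (m1 : {sigma_finite_measure set T1 -> \bar R})
    (m2 : {sigma_finite_measure set T2 -> \bar R})
    (F : set T2) (G : set (T1 * T2)) (c : \bar R) :
  measurable F -> measurable G -> (0 <= c)%E ->
  (forall y, F y -> (c <= m1 (ysection G y))%E) ->
  (c * m2 F <= (m1 \x m2) G)%E.
Proof.
move=> mF mG c0 H.
have -> : (m1 \x m2)%E G = (m1 \x^ m2)%E G.
  by apply: product_measure_unique => // *; exact: product_measure2E.
have mf := measurable_fun_ysection m1 mG.
apply: (@le_trans _ _ (\int[m2]_(y in F) c)%E); first by rewrite integral_cst.
apply: (@le_trans _ _ (\int[m2]_(y in F) (m1 (ysection G y)))%E).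
  apply: ge0_le_integral => //.
  exact: (measurable_funS measurableT (@subsetT _ _) mf).
exact: ge0_subset_integral.
Qed.

(** No measurability of [A] is assumed, so Fubini is applied to [G] and [G \ W]. Vertical sections
    of [G \ W] lie in those of [A], so [G \ W] is null; horizontal sections of [G] have measure at
    least 1 over [[0, 1[]. Hence [W] carries at least the measure 1. *)
Lemma fubini_sierpinski {R : realType}
    (A G W : set (measurableTypeR R * measurableTypeR R)) :
  measurable G -> measurable W -> A `<=` G -> G `\` A `<=` W ->
  (forall x, countable (xsection A x)) ->
  (forall y, 0 <= y < 1 -> countable (`[0, 1[%classic `\` ysection A y)) ->
  (1 <= (@lebesgue_measure R \x @lebesgue_measure R)%E W)%E.
Proof.
move=> mG mW AG GAW cx cy.
pose m : {measure set _ -> \bar R} :=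
  (@lebesgue_measure R \x @lebesgue_measure R)%E.
have mGW : measurable (G `\` W) by exact: measurableD.
have GW0 : m (G `\` W) = 0.
  apply: integral0_eq => x _ /=; apply: countable_lebesgue_measure0.
  apply: sub_countable (cx x); apply: subset_card_le => y.
  rewrite /xsection/= !inE => -[Gxy nW].
  by apply: contrapT => nA; apply/nW/GAW; split.
have m01 : measurable (`[0, 1[%classic : set (measurableTypeR R)) by [].
have l01 : lebesgue_measure (`[0, 1[%classic : set R) = 1%E.
  by rewrite lebesgue_measure_itv/= lte01 oppr0 adde0.
have G1 : (1 <= m G)%E.
  rewrite -[leLHS]mul1e -[X in (_ * X <= _)%E]l01.
  apply: product_measure_ge_ysection => // y; rewrite /= in_itv/= => y01.
  have mGy := measurable_ysection y mG.
  have c0 : lebesgue_measure (`[0, 1[%classic `\` ysection G y) = 0%E.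
    apply: countable_lebesgue_measure0; apply: sub_countable (cy y y01).
    apply: subset_card_le => x [x01 nG]; split=> //.
    by apply: contra_not nG; rewrite /ysection/= !inE; exact: AG.
  rewrite -l01.
  apply: (@le_trans _ _ (lebesgue_measure
      (ysection G y `|` (`[0, 1[%classic `\` ysection G y)))).
    apply: le_measure; rewrite ?inE//.
      by apply: measurableU => //; exact: measurableD.
    by move=> x x01; case: (pselect (ysection G y x)); [left|right].
  apply: le_trans (measureU2 _ _ _) _ => //; first exact: measurableD.
  rewrite -[leRHS]adde0; apply: leeD => //.
  by move/eqP: c0; rewrite eq_le => /andP[].
apply: (le_trans G1).
apply: (@le_trans _ _ (m (W `|` (G `\` W)))%E).
  apply: le_measure; rewrite ?inE//; first exact: measurableU.
  by move=> p Gp; case: (pselect (W p)); [left|right].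
apply: le_trans (measureU2 _ _ _) _ => //.
rewrite -[leRHS]adde0; apply: leeD => //.
by move/eqP: GW0; rewrite eq_le => /andP[].
Qed.

(** * Diameters, Hausdorff measure and the Euclidean distance *)

Lemma diam_ge0 {R : realType} (A : set (R * R)) : (0 <= diam A)%E.
Proof. by apply: ereal_sup_ubound; left. Qed.

Lemma le_diam {R : realType} (A : set (R * R)) (p q : R * R) :
  A p -> A q -> ((euclid_dist p q)%:E <= diam A)%E.
Proof.
by move=> Ap Aq; apply: ereal_sup_ubound; right; exists p => //; exists q.
Qed.

Lemma diam_le {R : realType} (A : set (R * R)) (M : \bar R) : (0 <= M)%E ->
  (forall p q, A p -> A q -> ((euclid_dist p q)%:E <= M)%E) -> (diam A <= M)%E.
Proof.
move=> M0 H; apply: ge_ereal_sup => _ [->//|[p Ap [q Aq <-]]]; exact: H.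
Qed.

Lemma le_diam_powR {R : realType} (d : R) (A B : set (R * R)) : 0 <= d ->
  (diam A <= diam B)%E -> (diam A `^ d <= diam B `^ d)%E.
Proof.
by move=> d0 AB; apply: gt0_ler_poweR => //; rewrite in_itv/= diam_ge0 leey.
Qed.

Lemma hausdorff_delta_le {R : realType} (d delta : R) (A : set (R * R))
    (U : (set (R * R))^nat) :
  A `<=` \bigcup_n U n -> (forall n, (diam (U n) <= delta%:E)%E) ->
  (hausdorff_delta d delta A <= \sum_(n <oo) (diam (U n) `^ d))%E.
Proof. by move=> AU Ud; apply: ereal_inf_lbound; exists U. Qed.

Lemma hausdorff_delta_lt {R : realType} (d delta : R) (A : set (R * R))
    (x : \bar R) : (hausdorff_delta d delta A < x)%E ->
  exists U : (set (R * R))^nat, [/\ A `<=` \bigcup_n U n,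
    forall n, (diam (U n) <= delta%:E)%E &
    (\sum_(n <oo) (diam (U n) `^ d) < x)%E].
Proof. by move=> /ereal_inf_lt[_ [U [AU Ud] <-] Ux]; exists U. Qed.

Lemma hausdorff_delta_ge0 {R : realType} (d delta : R) (A : set (R * R)) :
  (0 <= hausdorff_delta d delta A)%E.
Proof.
apply/ereal_infP => _ [U _ <-]; apply: nneseries_ge0 => n _ _.
exact: poweR_ge0.
Qed.

Lemma hausdorff_delta_le_measure {R : realType} (d delta : R)
    (A : set (R * R)) : 0 < delta ->
  (hausdorff_delta d delta A <= hausdorff_measure d A)%E.
Proof. by move=> delta0; apply: ereal_sup_ubound; exists delta. Qed.

Lemma hausdorff_measure_ge0 {R : realType} (d : R) (A : set (R * R)) :
  (0 <= hausdorff_measure d A)%E.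
Proof.
exact: le_trans (hausdorff_delta_ge0 d 1 A) (hausdorff_delta_le_measure _ _ _ _).
Qed.

Lemma le_hausdorff_measure {R : realType} (d : R) (A B : set (R * R)) :
  A `<=` B -> (hausdorff_measure d A <= hausdorff_measure d B)%E.
Proof.
move=> AB; apply: ge_ereal_sup => _ [delta delta0 <-].
apply: le_trans (hausdorff_delta_le_measure _ _ _ delta0).
apply: ereal_inf_le_tmp => _ [U [BU Ud] <-]; exists U => //; split=> //.
exact: subset_trans BU.
Qed.

Lemma euclid_dist_ge1 {R : realType} (p q : R * R) :
  `|p.1 - q.1| <= euclid_dist p q.
Proof.
by rewrite -sqrtr_sqr /euclid_dist ler_sqrt ?addr_ge0 ?sqr_ge0// lerDl sqr_ge0.
Qed.

Lemma euclid_dist_ge2 {R : realType} (p q : R * R) :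
  `|p.2 - q.2| <= euclid_dist p q.
Proof.
by rewrite -sqrtr_sqr /euclid_dist ler_sqrt ?addr_ge0 ?sqr_ge0// lerDr sqr_ge0.
Qed.

(** Both sides are squared. If [a'], [b'] are the coordinate gaps of [u], [v] and [D] is their
    distance, then [(a' + x)^2 + (b' + y)^2 <= (D + x + y)^2], because [a'^2 + b'^2 = D^2] and [a'],
    [b'] are at most [D]. *)
Lemma euclid_dist_perturb {R : realType} (p q u v : R * R) :
  euclid_dist p q <= euclid_dist u v +
    (`|p.1 - u.1| + `|q.1 - v.1| + (`|p.2 - u.2| + `|q.2 - v.2|)).
Proof.
have D1 := euclid_dist_ge1 u v; have D2 := euclid_dist_ge2 u v.
have D0 : 0 <= euclid_dist u v by exact: sqrtr_ge0.
have Dsq : euclid_dist u v ^+ 2 = (u.1 - v.1) ^+ 2 + (u.2 - v.2) ^+ 2.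
  by rewrite sqr_sqrtr// addr_ge0 ?sqr_ge0.
set D := euclid_dist u v in D1 D2 D0 Dsq *.
set x := `|p.1 - u.1| + `|q.1 - v.1|; set y := `|p.2 - u.2| + `|q.2 - v.2|.
have x0 : 0 <= x by rewrite addr_ge0.
have y0 : 0 <= y by rewrite addr_ge0.
have px : `|p.1 - q.1| <= `|u.1 - v.1| + x.
  have -> : p.1 - q.1 = (u.1 - v.1) + ((p.1 - u.1) - (q.1 - v.1)) by ring.
  by rewrite (le_trans (ler_normD _ _))// lerD2l ler_normB.
have py : `|p.2 - q.2| <= `|u.2 - v.2| + y.
  have -> : p.2 - q.2 = (u.2 - v.2) + ((p.2 - u.2) - (q.2 - v.2)) by ring.
  by rewrite (le_trans (ler_normD _ _))// lerD2l ler_normB.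
rewrite -(ger0_norm (addr_ge0 D0 (addr_ge0 x0 y0))) -sqrtr_sqr.
rewrite /euclid_dist ler_sqrt ?sqr_ge0//.
rewrite -(real_normK (num_real (p.1 - q.1))) -(real_normK (num_real (p.2 - q.2))).
move: Dsq.
rewrite -(real_normK (num_real (u.1 - v.1))) -(real_normK (num_real (u.2 - v.2))).
have := normr_ge0 (p.1 - q.1); have := normr_ge0 (p.2 - q.2).
have := normr_ge0 (u.1 - v.1); have := normr_ge0 (u.2 - v.2).
move: D1 D2 px py.
move: `|p.1 - q.1| `|p.2 - q.2| `|u.1 - v.1| `|u.2 - v.2| => a b a' b'.
move=> aD bD ax by_ b'0 a'0 b0 a0 Dsq.
have h1 : a ^+ 2 <= (a' + x) ^+ 2 by rewrite lerXn2r ?nnegrE ?addr_ge0.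
have h2 : b ^+ 2 <= (b' + y) ^+ 2 by rewrite lerXn2r ?nnegrE ?addr_ge0.
have h3 : a' * x <= D * x by rewrite ler_wpM2r.
have h4 : b' * y <= D * y by rewrite ler_wpM2r.
have h5 := mulr_ge0 x0 y0.
apply: le_trans (lerD h1 h2) _.
clear - Dsq h3 h4 h5; lra.
Qed.

(** * The image of the unit square has finite measure *)

Definition unit_square {R : realType} : set (R * R) :=
  [set p | 0 <= p.1 < 1 /\ 0 <= p.2 < 1].

Definition square_map {R : realType} (f : R -> R) (p : R * R) : R * R :=
  (f p.1, f p.2).

Definition same_cell {R : realType} (n : nat) (p q : R * R) : Prop :=
  dyadic_cell n p.1 = dyadic_cell n q.1 /\ dyadic_cell n p.2 = dyadic_cell n q.2.

(** Each of the four image coordinates moves by at most [C * r^n]. *)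
Lemma same_cell_dist {R : realType} (q r C : R) (f : R -> R) (n : nat)
    (a b u v : R * R) : cantor_embedding q r C f ->
  unit_square a -> unit_square b -> unit_square u -> unit_square v ->
  same_cell n a u -> same_cell n b v ->
  euclid_dist (square_map f a) (square_map f b) <=
    euclid_dist (square_map f u) (square_map f v) + 4 * C * r ^+ n.
Proof.
move=> [_ _ _ _ fC] [a1 a2] [b1 b2] [u1 u2] [v1 v2] [au1 au2] [bv1 bv2].
apply: (le_trans (euclid_dist_perturb _ _ (square_map f u) (square_map f v))).
have := fC _ _ _ a1 u1 au1; have := fC _ _ _ a2 u2 au2.
have := fC _ _ _ b1 v1 bv1; have := fC _ _ _ b2 v2 bv2.
rewrite lerD2l /=; lra.
Qed.

(** The [4^k] dyadic squares of level [k] have images of diameter at most [4 * C * r^k], whose power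
    [2 * q] is [(4 * C)^(2 * q) * 4^-k]. The sum is thus bounded independently of [k]. *)
Lemma hausdorff_measure_square_lty {R : realType} (q r C : R) (f : R -> R) :
  0 < q -> cantor_embedding q r C f ->
  (hausdorff_measure (q * 2) (square_map f @` unit_square) < +oo)%E.
Proof.
move=> q0 emb; have [/andP[r0 r1] C0 rq _ _] := emb.
have d0 : 0 < q * 2 by rewrite mulr_gt0.
apply: (@le_lt_trans _ _ ((4 * C) `^ (q * 2))%:E); last exact: ltry.
apply: ge_ereal_sup => _ [delta /= delta0 <-].
have C40 : 0 <= 4 * C by rewrite mulr_ge0.
have [k kdelta] : exists k, 4 * C * r ^+ k <= delta.
  by apply: exists_scaled_expr_le; rewrite ?(ltW r0).
have B0 : 0 <= 4 * C * r ^+ k by rewrite mulr_ge0// exprn_ge0// ltW.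
(* The index [m] encodes the pair of cells as quotient and remainder by [2^k], so [U m] is empty
   from [4^k] on. *)
pose U m := square_map f @` [set p | unit_square p /\
  (dyadic_cell k p.1 = m %/ 2 ^ k /\ dyadic_cell k p.2 = m %% 2 ^ k)%N].
have cell_lt (t : R) : 0 <= t < 1 -> (dyadic_cell k t < 2 ^ k)%N.
  move=> /andP[t0 t1]; rewrite /dyadic_cell truncn_lt_nat ?mulr_ge0 ?exprn_ge0//.
  by rewrite natrX gtr_pMr ?exprn_gt0.
have diamU m : (diam (U m) <= (4 * C * r ^+ k)%:E)%E.
  apply: diam_le; first by rewrite lee_fin.
  move=> _ _ [p [Qp [p1 p2]] <-] [p' [Qp' [p1' p2']] <-]; rewrite lee_fin.
  (* Comparison with the degenerate pair [p'], [p'], at distance 0. *)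
  apply: le_trans (same_cell_dist q r C f k p p' p' p' emb _ _ _ _ _ _) _ => //.
    by split; rewrite ?p1 ?p2 ?p1' ?p2'.
  by rewrite /euclid_dist !subrr expr0n/= addr0 sqrtr0 add0r.
apply: (@le_trans _ _ (\sum_(n <oo) (diam (U n) `^ (q * 2)))%E).
  apply: hausdorff_delta_le.
    move=> _ [p Qp <-]; have [Qp1 Qp2] := Qp.
    exists (dyadic_cell k p.1 * 2 ^ k + dyadic_cell k p.2)%N => //.
    exists p => //; split=> //.
    by rewrite divnMDl ?expn_gt0// modnMDl divn_small ?modn_small ?addn0 ?cell_lt.
  by move=> n; apply: (le_trans (diamU n)); rewrite lee_fin.
pose c := (4 * C * r ^+ k) `^ (q * 2).
apply: (@le_trans _ _
    (\sum_(n <oo) (if (n < 4 ^ k)%N then c%:E else 0%E))%E).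
  apply: lee_nneseries => [n _ _|n _]; first exact: poweR_ge0.
  case: ifPn => [_|].
    rewrite /c -poweR_EFin; apply: gt0_ler_poweR => //; first exact: ltW.
    - by rewrite in_itv/= diam_ge0 leey.
    - by rewrite in_itv/= lee_fin B0 leey.
  rewrite -leqNgt => kn.
  have -> : U n = set0.
    rewrite -subset0 => z [p [[Qp _] [p1 _]] _].
    have := cell_lt _ Qp; rewrite p1 ltnNge => /negP; apply.
    by rewrite leq_divRL ?expn_gt0// -expnMn.
  (* The point 0 adjoined in [diam] makes the empty pieces contribute 0. *)
  have -> : diam (set0 : set (R * R)) = 0%E.
    by apply/eqP; rewrite eq_le diam_ge0 andbT; apply: diam_le.
  by rewrite poweR0r// gt_eqF.
rewrite (nneseries_split 0 (4 ^ k)); last first.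
  by move=> i _; case: ifP; rewrite ?lee_fin ?powR_ge0.
rewrite eseries0 ?adde0; last first.
  by move=> i /=; rewrite add0n leqNgt => /negPf ->.
rewrite add0n (eq_big_nat _ _ (F2 := fun=> c%:E)); last first.
  by move=> i /andP[_ ->].
rewrite sumEFin sumr_const_nat subn0 lee_fin /c powRM ?exprn_ge0 ?(ltW r0)//.
rewrite powRrM [X in _ * X]powRrM -[r ^+ k]powR_mulrn ?(ltW r0)// (powRAC r).
rewrite rq !powR_mulrn ?powR_ge0 ?invr_ge0//.
rewrite -[_ *+ (4 ^ k)%N]mulr_natr natrX -mulrA exprAC -exprMn.
have -> : (2^-1 ^+ 2 * 4 : R) = 1 by field.
by rewrite expr1n mulr1.
Qed.

(** * Measurable hulls inside the unit square *)

Lemma measurable_dyadic_cell {R : realType} (n i : nat) :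
  measurable ([set t | 0 <= t < 1 /\ dyadic_cell n t = i] :
    set (measurableTypeR R)).
Proof.
have -> : [set t | 0 <= t < 1 /\ dyadic_cell n t = i] =
    `[0, 1[%classic `&` `[(i%:R / 2 ^+ n : R), (i.+1%:R / 2 ^+ n)[%classic.
  have n0 : 0 < 2 ^+ n :> R by rewrite exprn_gt0.
  apply/seteqP; split=> t /=; rewrite !in_itv/= ler_pdivrMr// ltr_pdivlMr//;
    rewrite [t * _]mulrC => -[/[dup] t01 /andP[t0 _]].
    by move=> /(dyadic_cellP _ _ _ t0).
  by move=> /(dyadic_cellP _ _ _ t0).
by apply: measurableI.
Qed.

(* The points approximated by preimages of [U], cell by cell. Only
   countable operations on dyadic squares are involved, so it is measurable
   whatever [U] is. *)
Definition cell_closure {R : realType} (f : R -> R) (U : set (R * R)) :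
    set (R * R) :=
  [set p | unit_square p /\ forall n, exists u,
     [/\ unit_square u, U (square_map f u) & same_cell n u p]].

Lemma measurable_cell_closure {R : realType} (f : R -> R) (U : set (R * R)) :
  measurable (cell_closure f U : set (measurableTypeR R * measurableTypeR R)).
Proof.
pose D n i : set (measurableTypeR R) :=
  [set t | 0 <= t < 1 /\ dyadic_cell n t = i].
(* The set [U] enters only by selecting pairs of indices, and any such selection is countable. *)
pose P n i j := exists u, [/\ unit_square u, U (square_map f u) &
  dyadic_cell n u.1 = i /\ dyadic_cell n u.2 = j].
have -> : cell_closure f U =
    \bigcap_n \bigcup_i \bigcup_(j in [set j | P n i j]) (D n i `*` D n j).
  apply/seteqP; split=> p.
    move=> [[p1 p2] H] n _; have [u [Qu Uu [u1 u2]]] := H n.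
    exists (dyadic_cell n p.1) => //; exists (dyadic_cell n p.2); last by [].
    by exists u.
  move=> H; have Q : unit_square p.
    by have [i _ [j _ [[p1 _] [p2 _]]]] := H 0%N Logic.I.
  split=> // n; have [i _ [j [u [Qu Uu [u1 u2]]] [[_ p1] [_ p2]]]] := H n Logic.I.
  by exists u; split=> //; split; rewrite ?u1 ?u2.
apply: bigcapT_measurable => n; apply: bigcupT_measurable => i.
apply: bigcup_measurable => j _.
by apply: measurableX; exact: measurable_dyadic_cell.
Qed.

(** Two points of the closure are matched, at each level [n], with points of [U] at the cost of
    [4 * C * r^n], which tends to 0. *)
Lemma diam_cell_closure {R : realType} (q r C : R) (f : R -> R)
    (U : set (R * R)) : cantor_embedding q r C f ->
  (diam (square_map f @` cell_closure f U) <= diam U)%E.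
Proof.
move=> emb; have [/andP[r0 r1] C0 _ _ _] := emb.
apply: diam_le; first exact: diam_ge0.
move=> _ _ [a [Qa Ha] <-] [b [Qb Hb] <-]; apply/lee_addgt0Pr => e e0.
have [n ne] : exists n, 4 * C * r ^+ n <= e.
  by apply: exists_scaled_expr_le; rewrite ?mulr_ge0 ?(ltW r0).
have [u [Qu Uu [ua1 ua2]]] := Ha n; have [v [Qv Uv [vb1 vb2]]] := Hb n.
apply: (@le_trans _ _ (euclid_dist (square_map f u) (square_map f v) + e)%:E).
  rewrite lee_fin.
  apply: le_trans (same_cell_dist q r C f n a b u v _ _ _ _ _ _ _) _ => //.
  by rewrite lerD2l.
by rewrite EFinD leeD2r// le_diam.
Qed.

(** For each [k] take a cover of the image of [E] at scale [1 / (k + 1)] that is optimal up to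
    [1 / (k + 1)], and replace its members by their cell closures, which are measurable with images
    of no larger diameter. [G] is the intersection over [k] of the resulting unions. *)
Lemma hausdorff_measurable_hull {R : realType} (q r C : R) (f : R -> R)
    (E : set (R * R)) : 0 < q -> cantor_embedding q r C f ->
  E `<=` unit_square ->
  (hausdorff_measure (q * 2) (square_map f @` E) < +oo)%E ->
  exists G : set (R * R), [/\
    measurable (G : set (measurableTypeR R * measurableTypeR R)),
    E `<=` G, G `<=` unit_square &
    (hausdorff_measure (q * 2) (square_map f @` G) <=
       hausdorff_measure (q * 2) (square_map f @` E))%E].
Proof.
move=> q0 emb EQ; set h := hausdorff_measure _ (_ @` E) => hoo.
have hfin : h \is a fin_num by rewrite ge0_fin_numE// hausdorff_measure_ge0.
have /choice[V HV] (k : nat) : exists U : (set (R * R))^nat, [/\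
    square_map f @` E `<=` \bigcup_n U n,
    forall n, (diam (U n) <= (k.+1%:R^-1)%:E)%E &
    (\sum_(n <oo) (diam (U n) `^ (q * 2)) < h + (k.+1%:R^-1)%:E)%E].
  apply: hausdorff_delta_lt; apply: (@le_lt_trans _ _ h).
    by apply: hausdorff_delta_le_measure; rewrite invr_gt0.
  by rewrite lteDl// lte_fin invr_gt0.
exists (\bigcap_k \bigcup_n cell_closure f (V k n)); split.
- apply: bigcapT_measurable => k; apply: bigcupT_measurable => n.
  exact: measurable_cell_closure.
- move=> p Ep k _; have [EV _ _] := HV k.
  have [n _ Vp] := EV _ (imageP (square_map f) Ep).
  exists n => //; split; first exact: EQ.
  by move=> m; exists p; split=> //; exact: EQ.
- by move=> p /(_ 0%N Logic.I)[n _ []].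
- apply: ge_ereal_sup => _ [delta /= delta0 <-].
  apply/lee_addgt0Pr => e e0.
  have [k [ke kdelta]] : exists k : nat, k.+1%:R^-1 <= e /\ k.+1%:R^-1 <= delta.
    have m0 : 0 < Num.min e delta by rewrite lt_min e0.
    have [k _ /(_ k (leqnn _)) /= /ltW] := near_infty_natSinv_lt (PosNum m0).
    by rewrite /= le_min => /andP[]; exists k.
  have [EV Vd Vsum] := HV k.
  apply: (@le_trans _ _ (\sum_(n <oo)
      diam (square_map f @` cell_closure f (V k n)) `^ (q * 2))%E).
    apply: hausdorff_delta_le.
      by move=> _ [p /(_ k Logic.I)[n _ pn] <-]; exists n => //; exists p.
    move=> n; apply: (le_trans (diam_cell_closure q r C f (V k n) emb)).
    by apply: (le_trans (Vd n)); rewrite lee_fin.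
  apply: (@le_trans _ _ (\sum_(n <oo) (diam (V k n) `^ (q * 2)))%E).
    apply: lee_nneseries => [n _ _|n _]; first exact: poweR_ge0.
    apply: le_diam_powR; first by rewrite mulr_ge0// ltW.
    exact: (diam_cell_closure q r C f).
  by apply: (le_trans (ltW Vsum)); rewrite leeD2l// lee_fin.
Qed.

(** * From Hausdorff-null images to Lebesgue-null sets *)

(** By the Hoelder bound, the preimage of a set of diameter [D] lies in a square of half-side
    [2 * D^q], hence of area [16 * D^(2 * q)]. Summing over a cover of total less than [e / 16]
    gives [e]. *)
Lemma hausdorff_null_cover {R : realType} (q r C : R) (f : R -> R)
    (E : set (R * R)) (e : R) : 0 < q -> cantor_embedding q r C f ->
  E `<=` unit_square -> 0 < e ->
  hausdorff_measure (q * 2) (square_map f @` E) = 0%E ->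
  exists W : set (measurableTypeR R * measurableTypeR R), [/\ measurable W,
    E `<=` W & ((@lebesgue_measure R \x @lebesgue_measure R) W <= e%:E)%E].
Proof.
move=> q0 emb EQ e0 hE; have [_ _ _ fq _] := emb.
(* The scale 1 serves to make all diameters finite. *)
have [U [EU Ud Usum]] : exists U : (set (R * R))^nat, [/\
    square_map f @` E `<=` \bigcup_n U n, forall n, (diam (U n) <= 1%:E)%E &
    (\sum_(n <oo) (diam (U n) `^ (q * 2)) < (e / 16)%:E)%E].
  apply: hausdorff_delta_lt; apply: (@le_lt_trans _ _ 0%E).
    by rewrite -hE; exact: hausdorff_delta_le_measure.
  by rewrite lte_fin divr_gt0.
have Ufin n : diam (U n) \is a fin_num.
  by rewrite ge0_fin_numE ?diam_ge0// (le_lt_trans (Ud n))// ltry.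
have /choice[W HW] (n : nat) : exists Wn : set (measurableTypeR R * measurableTypeR R),
    [/\ measurable Wn, [set p | unit_square p /\ U n (square_map f p)] `<=` Wn &
    ((@lebesgue_measure R \x @lebesgue_measure R) Wn <=
      16%:E * diam (U n) `^ (q * 2))%E].
  have [[a [Qa Ua]]|nU] :=
    pselect (exists a, unit_square a /\ U n (square_map f a)); last first.
    exists set0; split=> //.
      by move=> p Up; apply: nU; exists p.
    by rewrite measure0 mule_ge0// poweR_ge0.
  pose rho := 2 * fine (diam (U n)) `^ q.
  have rho0 : 0 <= rho by rewrite mulr_ge0// powR_ge0.
  pose I (t : R) : set (measurableTypeR R) := `[t - rho, t + rho]%classic.
  have mI t : measurable (I t) by exact: measurable_itv.
  exists (I a.1 `*` I a.2); split; first exact: measurableX.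
    move=> p [Qp Up].
    have dUn (x : R) : 0 <= x -> x <= euclid_dist (square_map f a) (square_map f p) ->
        2 * x `^ q <= rho.
      move=> x0 xd; rewrite ler_pM2l// ge0_ler_powR ?(ltW q0) ?nnegrE//.
        by rewrite fine_ge0// diam_ge0.
      by rewrite (le_trans xd)// -lee_fin fineK// le_diam.
    have [[a1 a2] [p1 p2]] := (Qa, Qp).
    have h1 := le_trans (fq _ _ a1 p1) (dUn _ (normr_ge0 _) (euclid_dist_ge1 _ _)).
    have h2 := le_trans (fq _ _ a2 p2) (dUn _ (normr_ge0 _) (euclid_dist_ge2 _ _)).
    move: h1 h2; rewrite !ler_norml => /andP[h1 h1'] /andP[h2 h2'].
    by split; rewrite /I/= in_itv/=; apply/andP; split; lra.
  have lI t : (lebesgue_measure (I t) <= (2 * rho)%:E)%E.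
    rewrite lebesgue_measure_itv/=; case: ifPn => _.
      by rewrite -EFinD lee_fin; lra.
    by rewrite lee_fin mulr_ge0.
  rewrite product_measure1E//.
  apply: (@le_trans _ _ ((2 * rho)%:E * (2 * rho)%:E)%E).
    by apply: lee_pmul; rewrite ?measure_ge0 ?lI.
  rewrite -EFinM -[diam (U n)]fineK// poweR_EFin -EFinM lee_fin.
  rewrite powRrM [X in _ <= _ * X](_ : _ = (fine (diam (U n)) `^ q) ^+ 2).
    by rewrite /rho; lra.
  by rewrite powR_mulrn// powR_ge0.
exists (\bigcup_n W n); split.
- by apply: bigcupT_measurable => n; have [] := HW n.
- move=> p Ep; have [n _ Up] := EU _ (imageP (square_map f) Ep).
  by exists n => //; have [_ + _] := HW n; apply; split=> //; exact: EQ.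
- apply: le_trans (measure_sigma_subadditive _ _ _ (@subset_refl _ _)) _.
  + by move=> n; have [] := HW n.
  + by apply: bigcupT_measurable => n; have [] := HW n.
  apply: (@le_trans _ _ (\sum_(n <oo) (16%:E * diam (U n) `^ (q * 2)))%E).
    by apply: lee_nneseries => // n _; have [] := HW n.
  rewrite nneseriesZl; last by move=> n _; exact: poweR_ge0.
  have -> : e%:E = (16%:E * (e / 16)%:E)%E by rewrite -EFinM; congr EFin; field.
  by rewrite lee_pmul2l ?lte_fin ?ltW.
Qed.

(** * Pulling the Sierpinski set back to the unit square *)

Lemma countable_injective_preimage {T U : Type} (g : T -> U) (A : set T)
    (B : set U) : {in A &, injective g} -> (forall x, A x -> B (g x)) ->
  countable B -> countable A.
Proof.
move=> ginj AB /countable_injP[h hinj]; apply/countable_injP.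
exists (h \o g) => x y /[dup] xA /set_mem Ax /[dup] yA /set_mem Ay /= hxy.
by apply: ginj => //; apply: hinj hxy; rewrite inE; exact: AB.
Qed.

Lemma cantor_embedding_inj {R : realType} (q r C : R) (f : R -> R) (s t : R) :
  0 < q -> cantor_embedding q r C f -> 0 <= s < 1 -> 0 <= t < 1 ->
  f s = f t -> s = t.
Proof.
move=> q0 [_ _ _ fq _] hs ht e; have := fq s t hs ht.
rewrite e subrr normr0 powR0 ?gt_eqF// mulr0 normr_le0 subr_eq0.
by move=> /eqP.
Qed.

Theorem theorem2p1 (R : realType) (d : R) (d_gt0 : 0 < d) (d_le2 : d <= 2) :
  ~ exists S : set (R * R),
      (hausdorff_measure d).-caratheodory S /\ sierpinski_cardinality S.
Proof.
move=> [S [mS [Sv Sh]]].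
have q0 : 0 < d / 2 by rewrite divr_gt0.
have q1 : d / 2 <= 1 by rewrite ler_pdivrMr// mul1r.
have [f [r [C emb]]] := exists_cantor_embedding (d / 2) q0 q1.
have dE : d = d / 2 * 2 by rewrite mulfVK.
set q := d / 2 in q0 q1 emb dE; rewrite {}dE in mS.
have inj := cantor_embedding_inj q r C f _ _ q0 emb.
pose A : set (R * R) := [set p | unit_square p /\ S (square_map f p)].
have AQ : A `<=` unit_square by move=> p [].
have Aoo : (hausdorff_measure (q * 2) (square_map f @` A) < +oo)%E.
  apply: le_lt_trans (hausdorff_measure_square_lty q r C f q0 emb).
  exact/le_hausdorff_measure/image_subset.
have [G [mG AG GQ hG]] := hausdorff_measurable_hull q r C f A q0 emb AQ Aoo.
have GA0 : hausdorff_measure (q * 2) (square_map f @` (G `\` A)) = 0%E.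
  apply/eqP; rewrite eq_le hausdorff_measure_ge0 andbT.
  have Afin : hausdorff_measure (q * 2) (square_map f @` A) \is a fin_num.
    by rewrite ge0_fin_numE// hausdorff_measure_ge0.
  (* [S] splits the image of [G] into a part containing the image of [A] and one containing that of
     [G \ A], as [G] lies in the unit square. The finite measure of the image of [A] then
     cancels. *)
  rewrite -(leeD2lE _ _ Afin) adde0; apply: le_trans hG; rewrite [leRHS]mS.
  apply: leeD; apply: le_hausdorff_measure.
    by move=> _ [p Ap <-]; split; [exists p => //; exact: AG|case: Ap].
  move=> _ [p [Gp nAp] <-]; split; first by exists p.
  by move=> Sp; apply: nAp; split=> //; exact: GQ.
have [W [mW GAW]] : exists W : set (measurableTypeR R * measurableTypeR R),
    [/\ measurable W, G `\` A `<=` W &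
      ((@lebesgue_measure R \x @lebesgue_measure R) W <= (2^-1)%:E)%E].
  apply: (hausdorff_null_cover q r C f) => //.
  by move=> p [/GQ].
(* The bound [1/2] on [W] contradicts the lower bound 1. *)
apply/negP; rewrite -ltNge; apply: (@lt_le_trans _ _ 1%E).
  by rewrite lte_fin invf_lt1// ltr1n.
apply: (fubini_sierpinski A G W) => //.
(* Sections of [A] are carried injectively into [S] on the vertical line at [f x]; below,
   complements of sections go off [S] on the horizontal line at [f y]. *)
- move=> x; apply: (countable_injective_preimage (fun y => (f x, f y))) (Sv (f x)).
    move=> y y'; rewrite /xsection !inE/= !inE => -[[_ y01] _] [[_ y'01] _] [].
    exact: inj.
  by move=> y; rewrite /xsection/= inE => -[_ Sp]; split.
- move=> y y01.
  apply: (countable_injective_preimage (fun x => (f x, f y))) (Sh (f y)).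
    move=> x x'; rewrite !inE/= !in_itv/= => -[x01 _] [x'01 _] [].
    exact: inj.
  move=> x [/=]; rewrite in_itv/= /ysection/= inE => x01 nA; split=> // Sp.
  by apply: nA; split.
Qed.
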